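(* Let $n\ge 1$, let $\delta\ge 0$, and let $X_1,\dots,X_n$ be $\delta$-hyperbolic spaces. Let $G$ be a group and for each $i=1,\dots,n$ let $\rho_i\colon G\to \operatorname{Isom}(X_i)$ be a homomorphism such that: (1) there is an element $f_i\in G$ such that $\rho_i(f_i)$ is hyperbolic; and (2) for each $g\in G$, either $\rho_i(g)$ has a periodic orbit or $\rho_i(g)$ is hyperbolic. Then there is an element $f\in G$ such that $\rho_i(f)$ is hyperbolic for all $i=1,\dots,n$.
   Context: A $\delta$-hyperbolic space is a geodesic metric space $(X,d)$ in which every geodesic triangle is $\delta$-slim: each side is contained in the closed $\delta$-neighborhood of the union of the other two sides. $\operatorname{Isom}(X)$ is the group of isometries of $X$. An isometry $h\in\operatorname{Isom}(X)$ is hyperbolic if for every $x\in X$ there is $t>0$ such that $t|m-n|\le d(h^m x,h^n x)$ for all $m,n\in\mathbb{Z}$. An isometry $h$ of $X$ has a periodic orbit if there are $x\in X$ and an integer $k\ge 1$ with $h^k x=x$. *)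

(* Defs.v *)
From HB Require Import structures.
From mathcomp Require Import all_boot all_order all_algebra.
From mathcomp Require Import boolp classical_sets set_interval reals ereal.
From mathcomp Require Import constructive_ereal topology.

Set Implicit Arguments.
Unset Strict Implicit.
Unset Printing Implicit Defensive.

Import Order.TTheory GRing.Theory Num.Theory.

Local Open Scope classical_set_scope.
Local Open Scope ring_scope.

Definition expgz (G : groupType) (g : G) (k : int) : G :=
  match k with
  | Posz n => (g ^+ n)%g
  | Negz n => (g ^- n.+1)%g
  end.

Section Geodesics.
Context {R : realType} {X : metricType R}.
Implicit Types (x y z : X) (A S : set X).

(* The path is a total function on R, but only its values on [0, d(x, y)]
   matter. *)
Definition geodesic x y (c : R -> X) : Prop :=
  [/\ c 0 = x, c (mdist x y) = y &
      {in `[0, mdist x y] &, forall s t, mdist (c s) (c t) = `|s - t|}].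

Definition geodesic_segment x y S : Prop :=
  exists2 c : R -> X, geodesic x y c & S = c @` `[0, mdist x y].

(* The infimum is taken in the extended reals, so that it is +oo, and not 0,
   on the empty set. *)
Definition closed_neighborhood (r : R) A : set X :=
  [set x | (ereal_inf [set (mdist x a)%:E | a in A] <= r%:E)%E].

Definition slim_triangle (delta : R) (S1 S2 S3 : set X) : Prop :=
  [/\ S1 `<=` closed_neighborhood delta (S2 `|` S3),
      S2 `<=` closed_neighborhood delta (S3 `|` S1) &
      S3 `<=` closed_neighborhood delta (S1 `|` S2)].

End Geodesics.

Definition geodesic_space {R : realType} (X : metricType R) : Prop :=
  forall x y : X, exists S, geodesic_segment x y S.

Definition hyperbolic_space {R : realType} (delta : R) (X : metricType R) :
    Prop :=
  geodesic_space X /\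
  forall (x y z : X) (S1 S2 S3 : set X),
    geodesic_segment x y S1 -> geodesic_segment y z S2 ->
    geodesic_segment z x S3 -> slim_triangle delta S1 S2 S3.

(* Injectivity follows from Isom_mdist.  The group law below is composition,
   (f * g) x = f (g x), so homomorphisms into Isom X are left actions. *)
Record Isom {R : realType} (X : metricType R) := MkIsom {
  Isom_fun :> X -> X;
  Isom_mdist : forall x y,
    mdist (Isom_fun x) (Isom_fun y) = mdist x y;
  Isom_surj : forall y, exists x, Isom_fun x = y }.

Section IsometryGroup.
Context {R : realType} {X : metricType R}.
Implicit Types f g h : Isom X.

HB.instance Definition _ := gen_eqMixin (Isom X).
HB.instance Definition _ := gen_choiceMixin (Isom X).

Lemma Isom_ext f g : f =1 g -> f = g.
Proof.
case: f g => [f f1 f2] [g g1 g2] /= /funext fg; case: g / fg g1 g2 => g1 g2.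
by congr MkIsom; apply: Prop_irrelevance.
Qed.

Lemma Isom_inj f : injective f.
Proof.
move=> x y fxy; apply: (@mdist_positivity R).
by rewrite -(Isom_mdist f) fxy mdistxx.
Qed.

Lemma Isom_id_surj (y : X) : exists x, idfun x = y.
Proof. by exists y. Qed.

Definition Isom_one : Isom X :=
  @MkIsom R X idfun (fun _ _ => erefl) Isom_id_surj.

Lemma Isom_comp_mdist f g x y :
  mdist ((f \o g) x) ((f \o g) y) = mdist x y.
Proof. by rewrite /= !Isom_mdist. Qed.

Lemma Isom_comp_surj f g y : exists x, (f \o g) x = y.
Proof.
have [z <-] := Isom_surj f y; have [x <-] := Isom_surj g z.
by exists x.
Qed.

Definition Isom_mul f g : Isom X :=
  MkIsom (Isom_comp_mdist f g) (Isom_comp_surj f g).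

Definition Isom_inv_fun f (y : X) : X := sval (cid (Isom_surj f y)).

Lemma Isom_invKV f : cancel (Isom_inv_fun f) f.
Proof. by move=> y; rewrite /Isom_inv_fun; case: cid. Qed.

Lemma Isom_invK f : cancel f (Isom_inv_fun f).
Proof. by move=> x; apply: (@Isom_inj f); rewrite Isom_invKV. Qed.

Lemma Isom_inv_mdist f x y :
  mdist (Isom_inv_fun f x) (Isom_inv_fun f y) = mdist x y.
Proof. by rewrite -(Isom_mdist f) !Isom_invKV. Qed.

Lemma Isom_inv_surj f y : exists x, Isom_inv_fun f x = y.
Proof. by exists (f y); rewrite Isom_invK. Qed.

Definition Isom_inv f : Isom X :=
  MkIsom (Isom_inv_mdist f) (Isom_inv_surj f).

Lemma Isom_mulA : associative Isom_mul.
Proof. by move=> f g h; apply: Isom_ext. Qed.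

Lemma Isom_mul1 : left_id Isom_one Isom_mul.
Proof. by move=> f; apply: Isom_ext. Qed.

Lemma Isom_mulr1 : right_id Isom_one Isom_mul.
Proof. by move=> f; apply: Isom_ext. Qed.

Lemma Isom_mulV : left_inverse Isom_one Isom_inv Isom_mul.
Proof. by move=> f; apply: Isom_ext => x /=; rewrite Isom_invK. Qed.

Lemma Isom_mulrV : right_inverse Isom_one Isom_inv Isom_mul.
Proof. by move=> f; apply: Isom_ext => x /=; rewrite Isom_invKV. Qed.

HB.instance Definition _ := isGroup.Build (Isom X)
  Isom_mulA Isom_mul1 Isom_mulr1 Isom_mulV Isom_mulrV.

End IsometryGroup.

Definition hyperbolic_isometry {R : realType} {X : metricType R}
    (h : Isom X) : Prop :=
  forall x : X, exists2 t : R, 0 < t &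
    forall m n : int, t * `|m - n|%:~R <= mdist (expgz h m x) (expgz h n x).

Definition has_periodic_orbit {R : realType} {X : metricType R}
    (h : Isom X) : Prop :=
  exists (x : X) (k : nat), (0 < k)%N /\ (h ^+ k)%g x = x.

(* Main.v *)
Require Import Defs.
From mathcomp Require Import all_boot all_order all_algebra.
From mathcomp Require Import ring lra zify.
From mathcomp Require Import boolp classical_sets reals ereal topology.

(** Slim triangles give Gromov's four-point inequality with an additive error
[K] ([hyperbolic_space_four_point]), and everything else uses only that
inequality.  Because of the dichotomy between periodic and hyperbolic
elements, it is enough to recognise isometries with unbounded orbits, and the
four-point inequality provides a test: if h displaces x, and h^2 displaces x
by more than K beyond that, then the displacement of x under h^n grows
linearly, so that h is not periodic ([aperiodic_of_displacement]).

The spaces are handled one at a time.  Suppose that f acts hyperbolically on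
the earlier spaces, but with a periodic orbit on the new one, where some g is
hyperbolic.  The element sought has the form f^a g^b with first b, then a
large.

On an earlier space, f^a g^b is aperiodic for all large a (running through the
multiples of some k) unless g^b carries the attracting end of f to its
repelling end ([aperiodic_power_mul]).  If some positive power of g fixes the
repelling end, then no multiple of that power is bad, since the two ends of f
are different; otherwise there is at most one bad b > 0.  So in either case
all positive multiples of some M are good ([aperiodic_left_powers]), and by
taking products k and M can be made common to all the earlier spaces.

On the new space, pass to a power of f that fixes a point p.  If f^s g^j is
not detected as aperiodic, then f^s takes g^j p close to the direction of
g^-j p.  If this happens for s and s' > s, then f^(s'-s) nearly fixes the
direction of g^j p, which for large j is far from that of g^-j p; so it does
not happen for s' - s.  Taking s = N and s' = 2N, one of the exponents N and
2N is good for every N > 0 ([aperiodic_elliptic_mul]).  Thus b can be fixed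
first so that arbitrarily large a work on the new space, and then a is chosen
beyond the thresholds of the earlier spaces. *)

Set Implicit Arguments.
Unset Strict Implicit.
Unset Printing Implicit Defensive.

Import Order.TTheory GRing.Theory Num.Theory.

Local Open Scope ring_scope.

(** * Slim triangles and the four-point inequality *)

(** The three lemmas below restate the metric axioms over a [realType], so that
rewriting and linear arithmetic see all distances in one ordered field. *)
Section RealMetric.
Context {R : realType} {X : metricType R}.

Lemma mdistC (x y : X) : mdist x y = mdist y x.
Proof. exact: metric_sym. Qed.

Lemma mdist_self (x : X) : mdist x x = 0.
Proof. exact: mdistxx. Qed.

Lemma mdist_triangle (y x z : X) : mdist x z <= mdist x y + mdist y z.
Proof. exact: metric_triangle. Qed.

End RealMetric.

Definition four_point {R : realType} (K : R) (X : metricType R) : Prop :=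
  forall x y z w : X, mdist x z + mdist y w <=
    Num.max (mdist x y + mdist z w) (mdist x w + mdist y z) + K.

Section SlimTriangles.
Context {R : realType} {X : metricType R}.
Implicit Types (x y z w p q : X) (S : set X) (delta : R).

(** The extra 1 makes up for the infimum, which need not be attained. *)
Lemma closed_neighborhood_near delta S p :
  closed_neighborhood delta S p -> exists2 q, S q & mdist p q <= delta + 1.
Proof.
rewrite /closed_neighborhood /= => h.
have /ereal_inf_lt [_ [q Sq <-]] :
  (ereal_inf [set (mdist p a)%:E | a in S] < (delta + 1)%:E)%E.
  by apply: le_lt_trans h _; rewrite lte_fin ltrDl.
by rewrite lte_fin => /ltW; exists q.
Qed.

Lemma geodesic_segment_dist x y S q :
  geodesic_segment x y S -> S q -> mdist x q + mdist q y = mdist x y.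
Proof.
move=> [c [c0 c1 cd] ->] [t /= tI <-].
have L0 := mdist_ge0 x y.
have I0 : 0 \in `[0, mdist x y] by rewrite in_itv /= lexx.
have I1 : mdist x y \in `[0, mdist x y] by rewrite in_itv /= lexx andbT.
rewrite -{1}c0 -{1}c1 !cd //.
move: tI; rewrite in_itv /= => /andP[t0 t1].
by rewrite sub0r normrN ger0_norm // ler0_norm ?subr_le0 //; ring.
Qed.

Lemma geodesic_segment_ends x y S : geodesic_segment x y S -> S x /\ S y.
Proof.
move=> [c [c0 c1 _] ->]; have L0 := mdist_ge0 x y; split.
  by exists 0 => //=; rewrite in_itv /= lexx.
by exists (mdist x y) => //=; rewrite in_itv /= lexx andbT.
Qed.

(** Walking along the side from z to x in steps of length at most 1, one starts
on S2 and ends on S1; the first step that comes near S1 is therefore within 1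
of a point near S2.  This discrete walk replaces a connectedness argument. *)
Lemma slim_side_center delta x y z S1 S2 S3 :
  hyperbolic_space delta X ->
  0 <= delta ->
  geodesic_segment x y S1 -> geodesic_segment y z S2 ->
  geodesic_segment z x S3 ->
  exists p, [/\ S3 p, exists2 q, S1 q & mdist p q <= delta + 1 &
    exists2 q, S2 q & mdist p q <= delta + 2].
Proof.
move=> [_ hyp] delta0 g1 g2 g3.
have [_ _ s3] := hyp _ _ _ _ _ _ g1 g2 g3.
have near p : S3 p -> (exists2 q, S1 q & mdist p q <= delta + 1) \/
    (exists2 q, S2 q & mdist p q <= delta + 1).
  by move=> /s3/closed_neighborhood_near[q [?|?] ?]; [left|right]; exists q.
have [[c [c0 c1 cd] S3E] L0] := (g3, mdist_ge0 z x).
set L := mdist z x in c1 cd S3E L0.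
(* The walk stops at the endpoint [L] once [j] exceeds it. *)
pose t (j : nat) : R := Num.min j%:R L.
have tI j : t j \in `[0, L].
  by rewrite in_itv /= /t le_min ler0n L0 ge_min lexx orbT.
have S3t j : S3 (c (t j)) by rewrite S3E; exists (t j) => //; exact: tI.
pose Q j := `[< exists2 q, S1 q & mdist (c (t j)) q <= delta + 1 >].
have exQ : exists j, Q j.
  exists (Num.bound L); apply/asboolP; exists x.
    by have [] := geodesic_segment_ends g1.
  have -> : t (Num.bound L) = L.
    by apply/min_idPr; apply: ltW; exact: archi_boundP.
  by rewrite c1 mdist_self; lra.
case: (ex_minnP exQ) => j0 /asboolP Qj minj; exists (c (t j0)).
split; [exact: S3t|exact: Qj|].
case: j0 Qj minj => [|j] Qj minj.
  have -> : t 0%N = 0 by apply/min_idPl.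
  rewrite c0; exists z; first by have [] := geodesic_segment_ends g2.
  by rewrite mdist_self; lra.
have [near1|[q S2q dq]] := near _ (S3t j).
  by have := minj j (asboolT near1); rewrite ltnn.
exists q => //; apply: le_trans (metric_triangle _ (c (t j)) _) _.
suff : mdist (c (t j.+1)) (c (t j)) <= 1 by lra.
rewrite cd ?tI // /t ler_norml -natr1 /Num.min /Order.min.
by case: ifP => h1; case: ifP => h2; lra.
Qed.

(** Take p on the diagonal from z to x close both to [x, y] and to [y, z]; it
is also close to [x, w] or to [w, z].  Hence p is close to two opposite sides
of the quadrilateral x, y, z, w, and both diagonals can be rerouted through p
along these two sides. *)
Lemma hyperbolic_space_four_point delta :
  0 <= delta -> hyperbolic_space delta X -> four_point (4 * delta + 6) X.
Proof.
move=> delta0 hyp x y z w; have geo := hyp.1.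
have [Sxy gxy] := geo x y; have [Syz gyz] := geo y z.
have [Szx gzx] := geo z x; have [Sxw gxw] := geo x w.
have [Swz gwz] := geo w z.
have [p [Sp [q1 Sq1 pq1] [q2 Sq2 pq2]]] :=
  slim_side_center hyp delta0 gxy gyz gzx.
have [_ _ s3] := hyp.2 _ _ _ _ _ _ gxw gwz gzx.
have [r Sr pr] := closed_neighborhood_near (s3 _ Sp).
have e1 := geodesic_segment_dist gxy Sq1.
have e2 := geodesic_segment_dist gyz Sq2.
rewrite -lerBlDr le_max; apply/orP.
have pc := mdistC.
case: Sr => Sr; [right|left].
- have e3 := geodesic_segment_dist gxw Sr.
  have t1 := mdist_triangle r x z; have t2 := mdist_triangle p r z.
  have t3 := mdist_triangle q2 p z; have t4 := mdist_triangle q2 y w.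
  have t5 := mdist_triangle p q2 w; have t6 := mdist_triangle r p w.
  have := pc _ _ p r; have := pc _ _ p q2; lra.
- have e3 := geodesic_segment_dist gwz Sr.
  have t1 := mdist_triangle q1 x z; have t2 := mdist_triangle p q1 z.
  have t3 := mdist_triangle r p z; have t4 := mdist_triangle q1 y w.
  have t5 := mdist_triangle p q1 w; have t6 := mdist_triangle r p w.
  have := pc _ _ p r; have := pc _ _ p q1; have := pc _ _ w r.
  have := pc _ _ w z; have := pc _ _ y q1; lra.
Qed.

End SlimTriangles.

(** * Displacement of a point under the powers of an isometry *)

Section IsometryPowers.
Context {R : realType} {X : metricType R}.
Implicit Types (h : Isom X) (x y : X).

Lemma Isom_expgSE h n x : (h ^+ n.+1)%g x = h ((h ^+ n)%g x).
Proof. by rewrite expgS. Qed.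

Lemma Isom_expgDE h m n x : (h ^+ (m + n))%g x = (h ^+ m)%g ((h ^+ n)%g x).
Proof. by rewrite expgnDr. Qed.

Lemma Isom_expgVK h n : cancel (h ^- n)%g (h ^+ n)%g.
Proof. by move=> x; rewrite -[LHS]/((h ^+ n * h ^- n)%g x) mulgV. Qed.

Lemma Isom_expg_fix h x n : h x = x -> (h ^+ n)%g x = x.
Proof. by move=> hx; elim: n => [//|n IHn]; rewrite Isom_expgSE IHn. Qed.

Lemma mdist_expg h x m n : (m <= n)%N ->
  mdist ((h ^+ m)%g x) ((h ^+ n)%g x) = mdist x ((h ^+ (n - m))%g x).
Proof. by move=> mn; rewrite -{1}(subnKC mn) Isom_expgDE Isom_mdist. Qed.

Lemma mdist_expgV h x n :
  mdist x ((h ^- n)%g x) = mdist x ((h ^+ n)%g x).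
Proof. by rewrite mdistC -(Isom_mdist (h ^+ n)%g) Isom_expgVK. Qed.

Lemma mdist_expgV_expg h x m n :
  mdist ((h ^- m)%g x) ((h ^+ n)%g x) = mdist x ((h ^+ (m + n))%g x).
Proof. by rewrite -(Isom_mdist (h ^+ m)%g) Isom_expgVK Isom_expgDE. Qed.

Lemma mdist_expgV_expgV h x m n : (m <= n)%N ->
  mdist ((h ^- m)%g x) ((h ^- n)%g x) = mdist x ((h ^+ (n - m))%g x).
Proof.
move=> mn; rewrite mdistC -(Isom_mdist (h ^+ n)%g) Isom_expgVK.
by rewrite -{1}(subnK mn) Isom_expgDE Isom_expgVK.
Qed.

Lemma mdist_expg_le h x n : mdist x ((h ^+ n)%g x) <= n%:R * mdist x (h x).
Proof.
elim: n => [|n IHn]; first by rewrite mul0r mdist_self.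
have := metric_triangle x ((h ^+ n)%g x) ((h ^+ n.+1)%g x).
rewrite (mdist_expg _ _ (leqnSn n)) subSnn -natr1 mulrDl mul1r.
by move=> /le_trans -> //; exact: lerD.
Qed.

End IsometryPowers.

(** The step [K + 1] beats the error of the four-point inequality, which makes
n |-> h^n x a quasi-geodesic with superadditive distances up to a constant;
see [strong_growth_superadditive]. *)
Definition strong_growth {R : realType} {X : metricType R} (K : R)
    (h : Isom X) (x : X) : Prop := forall n,
  mdist x ((h ^+ n)%g x) + (K + 1) <= mdist x ((h ^+ n.+1)%g x).

Section DisplacementGrowth.
Context {R : realType} {X : metricType R} {K : R}.
Hypotheses (K0 : 0 <= K) (X4 : four_point K X).
Implicit Types (h f g u : Isom X) (x y z w p : X) (eps : R).

(** Apply the four-point inequality to x, h x, h^2 x, h^(n+2) x: the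
alternative in which the displacement of h^n occurs is excluded by the
preceding step. *)
Lemma displacement_growth h x eps : 0 < eps ->
  mdist x (h x) + K + eps <= mdist x ((h ^+ 2)%g x) ->
  forall n, mdist x ((h ^+ n)%g x) + eps <= mdist x ((h ^+ n.+1)%g x).
Proof.
move=> eps0 h2; elim=> [|n IHn].
  have := mdist_expg_le h x 2; rewrite mdist_self; move: h2.
  by rewrite expg1; have := K0; lra.
have := X4 x (h x) ((h ^+ 2)%g x) ((h ^+ n.+2)%g x).
have -> : mdist (h x) ((h ^+ n.+2)%g x) = mdist x ((h ^+ n.+1)%g x).
  by rewrite Isom_expgSE Isom_mdist.
have -> : mdist (h x) ((h ^+ 2)%g x) = mdist x (h x).
  by rewrite Isom_expgSE Isom_mdist.
rewrite mdist_expg // subn2 /= => q.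
move: q; rewrite -lerBlDr le_max => /orP[]; move: h2 IHn; lra.
Qed.

Lemma displacement_growth_unbounded h x eps :
  (forall n, mdist x ((h ^+ n)%g x) + eps <= mdist x ((h ^+ n.+1)%g x)) ->
  forall n, n%:R * eps <= mdist x ((h ^+ n)%g x).
Proof.
move=> gr; elim=> [|n IHn]; first by rewrite mul0r mdist_self.
by rewrite -natr1 mulrDl mul1r; apply: le_trans (gr n); rewrite lerD2r.
Qed.

(** A periodic orbit would keep the displacement of x under h^(kn) below twice
the distance to the periodic point. *)
Lemma aperiodic_of_displacement h x :
  mdist x (h x) + K < mdist x ((h ^+ 2)%g x) -> ~ has_periodic_orbit h.
Proof.
set eps := mdist x ((h ^+ 2)%g x) - (mdist x (h x) + K).
move=> h2 [y [k [k0 hy]]].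
have eps0 : 0 < eps by rewrite /eps subr_gt0.
have gr : mdist x (h x) + K + eps <= mdist x ((h ^+ 2)%g x).
  by rewrite /eps; lra.
have unb := displacement_growth_unbounded (displacement_growth eps0 gr).
pose n := Num.bound (2 * mdist x y / eps).
have dxy0 : 0 <= 2 * mdist x y by rewrite mulr_ge0 // mdist_ge0.
have nP : 2 * mdist x y < n%:R * eps.
  by rewrite -ltr_pdivrMr //; apply: archi_boundP; rewrite divr_ge0 // ltW.
have lekn : n%:R * eps <= (k * n)%:R * eps :> R.
  by rewrite ler_wpM2r ?ler_nat ?leq_pmull // ltW.
have fixkn : (h ^+ (k * n))%g y = y by rewrite expgnA; exact: Isom_expg_fix.
have := mdist_triangle y x ((h ^+ (k * n))%g x).
have -> : mdist y ((h ^+ (k * n))%g x) = mdist x y.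
  by rewrite -{1}fixkn Isom_mdist mdistC.
have := unb (k * n)%N; lra.
Qed.

(** If no power qualified, the displacements D would satisfy
D (2k) < D k + c for all k > 0, hence grow only linearly along the powers of
2, against the linear lower bound given by hyperbolicity. *)
Lemma hyperbolic_strong_growth h x : hyperbolic_isometry h ->
  exists2 k, (0 < k)%N & strong_growth K (h ^+ k)%g x.
Proof.
move=> /(_ x)[t t0 ht].
pose D n : R := mdist x ((h ^+ n)%g x).
have tD n : t * n%:R <= D n.
  by have := ht 0 n%:Z; rewrite sub0r normrN ger0_norm.
pose c := K + (K + 1).
have [[k k0 hk]|no] :=
    pselect (exists2 k, (0 < k)%N & D k + c <= D (k * 2)%N).
  exists k => // n; apply: displacement_growth; first by have := K0; lra.
  by move: hk; rewrite /c /D expgnA; lra.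
have D2 j : D (2 ^ j)%N <= D 1%N + j%:R * c.
  elim: j => [|j IHj]; first by rewrite mul0r addr0.
  have lt : D (2 ^ j * 2)%N < D (2 ^ j)%N + c.
    rewrite ltNge; apply/negP => ?; apply: no; exists (2 ^ j)%N => //.
    by rewrite expn_gt0.
  by rewrite expnSr -natr1; lra.
have sq (j : nat) : (j * j <= 2 ^ (2 * j))%N.
  by rewrite expnM (expnMn 2 2) leq_mul // ltnW // ltn_expl.
(* For such [j], [t * j ^ 2] exceeds [D 1 + 2 * j * c]. *)
pose j := (Num.bound ((D 1%N + 2 * c) / t)).+1.
have D10 : 0 <= D 1%N by exact: mdist_ge0.
have c0 : 0 <= c by rewrite /c; have := K0; lra.
have jP : (D 1%N + 2 * c) < j%:R * t.
  rewrite -ltr_pdivrMr // (lt_trans (archi_boundP _)) ?ltr_nat //.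
  by apply: divr_ge0; [lra|exact: ltW].
have j1 : 1 <= j%:R :> R by rewrite ler1n.
have := le_trans (tD _) (D2 (2 * j)%N).
have : t * (j * j)%:R <= t * (2 ^ (2 * j))%:R by rewrite ler_pM2l // ler_nat sq.
rewrite !natrM; nra.
Qed.

Lemma strong_growth_expg h x k : (0 < k)%N ->
  strong_growth K h x -> strong_growth K (h ^+ k)%g x.
Proof.
case: k => // k _ gr n; rewrite -!expgnA mulnSr.
elim: k (k.+1 * n)%N => [|k IHk] m; first by rewrite addn1; exact: gr.
have := gr (m + k.+1)%N; have := IHk m; rewrite -addnS; have := K0; lra.
Qed.

End DisplacementGrowth.

(** * Gromov products and coterminal sequences *)

(** Twice the Gromov product of y and z based at x. *)
Definition gprod {R : realType} {X : metricType R} (x y z : X) : R :=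
  mdist x y + mdist x z - mdist y z.

Section GromovProducts.
Context {R : realType} {X : metricType R} {K : R}.
Hypotheses (K0 : 0 <= K) (X4 : four_point K X).
Implicit Types (h f g u : Isom X) (x y z w p : X) (C : R).

Lemma gprodC x y z : gprod x y z = gprod x z y.
Proof. by rewrite /gprod [mdist y z]mdistC; ring. Qed.

(** The four-point inequality in its ultrametric form. *)
Lemma gprod_trans C x y z w :
  C <= gprod x y z -> C <= gprod x z w -> C - K <= gprod x y w.
Proof.
rewrite /gprod => h1 h2; have := X4 x y z w.
rewrite -lerBlDr le_max => /orP[] h3; have := mdistC y z; move: h1 h2 h3.
  by lra.
by lra.
Qed.

Lemma gprod_le x y z : gprod x y z <= 2 * mdist x z.
Proof.
by have := mdist_triangle z x y; rewrite /gprod [mdist z y]mdistC; lra.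
Qed.

Lemma gprod_shift_le h x y z :
  gprod x y z <= gprod x (h y) (h z) + 2 * mdist x (h x).
Proof.
rewrite /gprod Isom_mdist.
have := mdist_triangle x (h x) (h y); have := mdist_triangle x (h x) (h z).
rewrite !Isom_mdist [mdist (h x) x]mdistC; lra.
Qed.

(** For sequences that go to infinity, this says that they converge to the same
point of the Gromov boundary. *)
Definition coterminal x (s t : nat -> X) : Prop :=
  forall C, exists N, forall n, (N <= n)%N -> C <= gprod x (s n) (t n).

Lemma coterminal_sym x (s t : nat -> X) : coterminal x s t -> coterminal x t s.
Proof.
by move=> st C; have [N NP] := st C; exists N => n /NP; rewrite gprodC.
Qed.

Lemma coterminal_trans x (r s t : nat -> X) :
  coterminal x r s -> coterminal x s t -> coterminal x r t.
Proof.
move=> rs st C; have [N1 P1] := rs (C + K); have [N2 P2] := st (C + K).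
exists (maxn N1 N2) => n; rewrite geq_max => /andP[/P1 h1 /P2 h2].
by have := gprod_trans h1 h2; rewrite addrK.
Qed.

Lemma coterminal_Isom h x (s t : nat -> X) :
  coterminal x s t -> 
  coterminal x (fun n => h (s n)) (fun n => h (t n)).
Proof.
move=> st C; have [N NP] := st (C + 2 * mdist x (h x)).
exists N => n /NP /= h1; have := gprod_shift_le h x (s n) (t n); move: h1; lra.
Qed.

Section StrongGrowth.
Variables (f : Isom X) (x : X).
Hypothesis gr : strong_growth K f x.

Let D n : R := mdist x ((f ^+ n)%g x).

Let D_step n : D n + (K + 1) <= D n.+1. Proof. exact: gr. Qed.

Let D0 : D 0 = 0. Proof. exact: mdist_self. Qed.

Let D_ge0 n : 0 <= D n. Proof. exact: mdist_ge0. Qed.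

(** The four-point inequality for f^-m x, x, f x, f^(n+1) x; strong growth rules
out one of the two alternatives. *)
Lemma strong_growth_superadditive m n : D m + D n <= D (m + n) + (D 1 + K).
Proof.
have KK := K0; have D10 := D_ge0 1.
case: n => [|n]; first by rewrite addn0 D0; lra.
have := X4 ((f ^- m)%g x) x (f x) ((f ^+ n.+1)%g x).
have -> : mdist ((f ^- m)%g x) x = D m by rewrite mdistC mdist_expgV.
have -> : mdist ((f ^- m)%g x) (f x) = D m.+1.
  by have := mdist_expgV_expg f x m 1; rewrite expg1 addn1.
rewrite mdist_expgV_expg Isom_expgSE Isom_mdist -Isom_expgSE.
rewrite -/(D _) -/(D _) -/(D _) -[mdist x (f x)]/(D 1).
rewrite -lerBlDr le_max => /orP[]; have := D_step m; have := D_step n; lra.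
Qed.

Lemma strong_growth_ge n : n%:R * (K + 1) <= D n.
Proof. exact: displacement_growth_unbounded gr _. Qed.

Lemma strong_growth_large C : exists N, forall n, (N <= n)%N -> C < D n.
Proof.
exists (Num.bound `|C|) => n Nn; apply: lt_le_trans (strong_growth_ge n).
have h1 : `|C| < n%:R.
  by apply: lt_le_trans (archi_boundP _) _; rewrite ?ler_nat.
have := K0; have := ler_norm C; move: h1; have : 0 <= n%:R :> R by []; nra.
Qed.

Lemma gprod_opposite m n :
  gprod x ((f ^- m)%g x) ((f ^+ n)%g x) <= D 1 + K.
Proof.
rewrite /gprod mdist_expgV mdist_expgV_expg -/(D _) -/(D _) -/(D _).
have := strong_growth_superadditive m n; lra.
Qed.

Lemma gprod_forward m n : (m <= n)%N ->
  2 * D m - (D 1 + K) <= gprod x ((f ^+ m)%g x) ((f ^+ n)%g x).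
Proof.
move=> mn; rewrite /gprod (mdist_expg _ _ mn) -/(D _) -/(D _) -/(D _).
have := strong_growth_superadditive m (n - m); rewrite subnKC //; lra.
Qed.

Lemma gprod_backward m n : (m <= n)%N ->
  2 * D m - (D 1 + K) <= gprod x ((f ^- m)%g x) ((f ^- n)%g x).
Proof.
move=> mn; rewrite /gprod mdist_expgV_expgV // !mdist_expgV.
rewrite -/(D _) -/(D _) -/(D _).
have := strong_growth_superadditive m (n - m); rewrite subnKC //; lra.
Qed.

Lemma ends_not_coterminal :
  ~ coterminal x (fun n => (f ^+ n)%g x) (fun n => (f ^- n)%g x).
Proof.
move=> /(_ (D 1 + K + 1))[N /(_ N (leqnn N))].
have := gprod_opposite N N; rewrite gprodC; lra.
Qed.

(** Unboundedness along a subsequence already forces divergence, since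
(f^n x) and (f^-n x) converge at infinity; hence failing to be coterminal is as
strong as a uniform bound. *)
Lemma gprod_bounded_of_not_coterminal u :
  ~ coterminal x (fun n => u ((f ^+ n)%g x)) (fun n => (f ^- n)%g x) ->
  exists C, forall n, gprod x (u ((f ^+ n)%g x)) ((f ^- n)%g x) <= C.
Proof.
move=> ncot; apply: contrapT => unb; apply: ncot => C.
pose e := mdist x (u x).
(* Two applications of [gprod_trans] cost [2 * K]; comparing base points [x]
   and [u x] costs [2 * e]. *)
pose C' := C + 2 * e + 2 * K + (D 1 + K).
have e0 : 0 <= e by exact: mdist_ge0.
have [n hn] : exists n, C' < gprod x (u ((f ^+ n)%g x)) ((f ^- n)%g x).
  apply: contrapT => no; apply: unb; exists C' => n; rewrite leNgt.
  by apply/negP => ?; apply: no; exists n.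
exists n => m nm.
have hD : C' < 2 * D n.
  apply: lt_le_trans hn _.
  by rewrite (le_trans (gprod_le _ _ _)) // mdist_expgV.
have h1 := gprod_backward nm.
have h2 : 2 * D n - (D 1 + K) - 2 * e <=
    gprod x (u ((f ^+ m)%g x)) (u ((f ^+ n)%g x)).
  rewrite gprodC.
  have := gprod_shift_le u x ((f ^+ n)%g x) ((f ^+ m)%g x).
  have := gprod_forward nm; rewrite -/e; lra.
have KK := K0; have D10 := D_ge0 1.
have h3 : C + K + K <= gprod x (u ((f ^+ m)%g x)) (u ((f ^+ n)%g x)).
  by move: h2 hD; rewrite /C'; lra.
have h4 : C + K + K <= gprod x (u ((f ^+ n)%g x)) ((f ^- n)%g x).
  by move: hn; rewrite /C'; lra.
have h5 : C + K <= gprod x ((f ^- n)%g x) ((f ^- m)%g x).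
  by move: h1 hD; rewrite /C'; lra.
have h6 := gprod_trans h3 h4; rewrite addrK in h6.
by have := gprod_trans h6 h5; rewrite addrK.
Qed.

(** The point h^2 x for h = f^a u is reached through the broken path with
vertices f^-a x, x, u f^a x (up to an isometry and the displacement of u); its
angle at x is wide by [gprod_bounded_of_not_coterminal], so that h^2 displaces
x by almost twice the displacement of f^a. *)
Lemma aperiodic_power_mul u :
  ~ coterminal x (fun n => u ((f ^+ n)%g x)) (fun n => (f ^- n)%g x) ->
  exists N, forall a, (N <= a)%N -> ~ has_periodic_orbit (f ^+ a * u)%g.
Proof.
move=> /gprod_bounded_of_not_coterminal[C hC].
pose e := mdist x (u x).
have [N hN] := strong_growth_large (3 * e + C + K).
exists N => a /hN {}hN; apply: (@aperiodic_of_displacement _ _ _ K0 X4 _ x).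
set F := (f ^+ a)%g.
rewrite expg2.
change (mdist x (F (u x)) + K < mdist x (F (u (F (u x))))).
have E : mdist x (F (u (F (u x)))) = mdist ((f ^- a)%g x) (u (F (u x))).
  by rewrite -[LHS](Isom_mdist F^-1%g) -[F^-1%g (F _)]/((F^-1 * F)%g _) mulVg.
have t1 := mdist_triangle (u (F (u x))) ((f ^- a)%g x) (u (F x)).
have t3 := mdist_triangle (F x) x (F (u x)).
have t4 := mdist_triangle x (u x) (u (F x)).
have := hC a; rewrite /gprod mdist_expgV -/(D a) [mdist (u (F x)) _]mdistC.
move: t1 t3 t4 hN; rewrite !Isom_mdist [mdist (u x) x]mdistC.
rewrite -/e E -[mdist x (F x)]/(D a).
by lra.
Qed.
End StrongGrowth.
End GromovProducts.

(** * Products of powers of two isometries *)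

Section PairsOfIsometries.
Context {R : realType} {X : metricType R} {K : R}.
Hypotheses (K0 : 0 <= K) (X4 : four_point K X).
Implicit Types (h f g u : Isom X) (x y z w p : X) (C : R).

Lemma coterminal_Isom_inj h x (s t : nat -> X) :
  coterminal x (fun n => h (s n)) (fun n => h (t n)) -> coterminal x s t.
Proof.
move=> /(coterminal_Isom h^-1%g) st.
have hK (r : nat -> X) : (fun n => (h^-1)%g (h (r n))) = r.
  by apply/funext => n; rewrite -[LHS]/((h^-1 * h)%g (r n)) mulVg.
by rewrite !hK in st.
Qed.

(** If g^m fixes the repelling end of f for some m > 0, then so do its powers,
which therefore cannot bring the attracting end there.  If no such m exists,
at most one b > 0 has g^b send the attracting end to the repelling one, for two
such exponents would differ by an m of the first kind. *)
Lemma exists_power_moving_end f g x : strong_growth K f x ->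
  exists2 M, (0 < M)%N & forall j, (0 < j)%N ->
    ~ coterminal x (fun n => (g ^+ (M * j))%g ((f ^+ n)%g x))
        (fun n => (f ^- n)%g x).
Proof.
move=> gr; have tr := coterminal_trans X4.
set fwd := fun n => (f ^+ n)%g x; set bwd := fun n => (f ^- n)%g x.
have [[m m0 gm]|nofix] := pselect (exists2 m, (0 < m)%N &
    coterminal x (fun n => (g ^+ m)%g (bwd n)) bwd).
  exists m => // j _.
  have fix_bwd : coterminal x (fun n => (g ^+ (m * j))%g (bwd n)) bwd.
    elim: j => [|j IHj].
      by rewrite muln0; exact: tr (coterminal_sym gm) gm.
    have -> : (fun n => (g ^+ (m * j.+1))%g (bwd n)) =
        (fun n => (g ^+ m)%g ((g ^+ (m * j))%g (bwd n))).
      by apply/funext => n; rewrite mulnS Isom_expgDE.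
    exact: tr (coterminal_Isom _ IHj) gm.
  move=> bad; apply: (ends_not_coterminal K0 X4 gr).
  apply: (@coterminal_Isom_inj (g ^+ (m * j))%g).
  exact: tr bad (coterminal_sym fix_bwd).
have [[b b0 gb]|nomeet] := pselect (exists2 b, (0 < b)%N &
    coterminal x (fun n => (g ^+ b)%g (fwd n)) bwd); last first.
  by exists 1%N => // j j0 bad; apply: nomeet; exists j; rewrite // -[j]mul1n.
exists b.+1 => // j j0 bad; apply: nofix.
have bj : (b < b.+1 * j)%N by rewrite leq_pmulr.
exists (b.+1 * j - b)%N; first by rewrite subn_gt0.
apply: tr bad; apply: coterminal_sym.
have -> : (fun n => (g ^+ (b.+1 * j))%g (fwd n)) =
    (fun n => (g ^+ (b.+1 * j - b))%g ((g ^+ b)%g (fwd n))).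
  by apply/funext => n; rewrite -Isom_expgDE subnK // ltnW.
exact: coterminal_Isom.
Qed.

(** The divisibility conditions let several such statements, for different
spaces, be combined by multiplying the [k]s and the [M]s. *)
Lemma aperiodic_left_powers f g : hyperbolic_isometry f ->
  exists kM : nat * nat, [/\ (0 < kM.1)%N, (0 < kM.2)%N & forall b,
    (0 < b)%N -> (kM.2 %| b)%N -> exists N, forall a, (N <= a)%N ->
    (kM.1 %| a)%N -> ~ has_periodic_orbit (f ^+ a * g ^+ b)%g].
Proof.
move=> hf; have [[x _]|noX] := pselect (exists x : X, True); last first.
  exists (1, 1)%N; split=> // b _ _; exists 0%N => a _ _ [x _].
  by apply: noX; exists x.
have [k k0 gr] := hyperbolic_strong_growth K0 X4 x hf.
have [M M0 hM] := exists_power_moving_end g gr.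
exists (k, M); split=> // b b0 /= /dvdnP[j bE].
rewrite {}bE muln_gt0 mulnC in b0 *; have /andP[j0 _] := b0.
have [N hN] := aperiodic_power_mul K0 X4 gr (hM _ j0).
exists (k * N)%N => a Na /dvdnP[q aE]; rewrite {}aE [(q * k)%N]mulnC in Na *.
by rewrite expgnA; apply: hN; rewrite -(leq_pmul2l k0).
Qed.

(** The exponents s for which f^s g^j fails the test form a set that contains no
s, s' together with s' - s, as soon as g^j p is far from p.  Such a set misses
N or 2N for each N > 0. *)
Lemma aperiodic_elliptic_mul f g p :
  f p = p -> strong_growth K g p ->
  exists2 j, (0 < j)%N &
    forall N, exists2 s, (N <= s)%N & ~ has_periodic_orbit (f ^+ s * g ^+ j)%g.
Proof.
move=> fp gr.
pose D n : R := mdist p ((g ^+ n)%g p).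
have D10 : 0 <= D 1 by exact: mdist_ge0.
(* [3 * K] for three uses of the four-point inequality, and [D 1 + K] from
   [gprod_opposite]. *)
have [j0 hj0] := strong_growth_large K0 gr (D 1 + 4 * K).
have hj := hj0 _ (leqnSn j0); rewrite -/(D _) in hj.
set j := j0.+1 in hj; exists j => // N.
pose q := (g ^+ j)%g p; pose r := (g ^- j)%g p.
have e1 s z : mdist p ((f ^+ s)%g z) = mdist p z.
  by rewrite -{1}(Isom_expg_fix s fp) Isom_mdist.
pose bad s := D j - K <= gprod p ((f ^+ s)%g q) r.
have good s : ~ bad s -> ~ has_periodic_orbit (f ^+ s * g ^+ j)%g.
  move=> nbad; apply: (@aperiodic_of_displacement _ _ _ K0 X4 _ p).
  rewrite expg2.
  change (mdist p ((f ^+ s)%g q) + K <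
    mdist p ((f ^+ s)%g ((g ^+ j)%g ((f ^+ s)%g q)))).
  rewrite !e1 -/(D j).
  have -> : mdist p ((g ^+ j)%g ((f ^+ s)%g q)) = mdist r ((f ^+ s)%g q).
    by rewrite -[RHS](Isom_mdist (g ^+ j)%g) Isom_expgVK.
  move/negP: nbad; rewrite -ltNge /gprod e1 mdist_expgV -/(D j).
  rewrite [mdist _ r]mdistC; lra.
have diff s s' : (s <= s')%N -> bad s -> bad s' -> ~ bad (s' - s)%N.
  move=> ss' b1 b2 b3.
  have h1 : D j - 2 * K <= gprod p q ((f ^+ (s' - s))%g q).
    rewrite /bad gprodC in b2; have := gprod_trans X4 b1 b2.
    rewrite /gprod !e1 (mdist_expg _ _ ss'); lra.
  have h2 : D j - 2 * K <= gprod p ((f ^+ (s' - s))%g q) r.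
    by move: b3; rewrite /bad; have := K0; lra.
  have h3 := gprod_trans X4 h1 h2.
  have := gprod_opposite K0 X4 gr j j; rewrite gprodC -/q -/r -/(D 1).
  move: h3 hj; lra.
have [/good|/contrapT b1] := pselect (~ bad N.+1); first by exists N.+1.
have [/good|/contrapT b2] := pselect (~ bad (N.+1 + N.+1)%N).
  by exists (N.+1 + N.+1)%N => //; lia.
by have := diff _ _ (leq_addr _ _) b1 b2; rewrite addKn.
Qed.

Lemma aperiodic_right_power f g k M : (0 < k)%N -> (0 < M)%N ->
  has_periodic_orbit f -> hyperbolic_isometry g ->
  exists b, [/\ (0 < b)%N, (M %| b)%N & forall N, exists a,
    [/\ (N <= a)%N, (k %| a)%N & ~ has_periodic_orbit (f ^+ a * g ^+ b)%g]].
Proof.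
move=> k0 M0 [p [l [l0 fp]]] hg.
have [k' k'0 gr] := hyperbolic_strong_growth K0 X4 p hg.
have {}fp : (f ^+ (k * l))%g p = p by rewrite mulnC expgnA Isom_expg_fix.
have {}gr := strong_growth_expg K0 M0 gr; rewrite -expgnA in gr.
have [j j0 hj] := aperiodic_elliptic_mul fp gr.
exists (k' * M * j)%N; split; first by rewrite !muln_gt0 k'0 M0.
  by rewrite dvdn_mulr // dvdn_mull.
move=> N; have [s Ns hs] := hj N; exists (k * l * s)%N; split.
- by apply: leq_trans Ns _; rewrite leq_pmull // muln_gt0 k0.
- by rewrite -mulnA dvdn_mulr.
- by rewrite !(expgnA _ (_ * _)).
Qed.

End PairsOfIsometries.

(** * Simultaneous hyperbolicity *)

Lemma multiplicative_expg (G H : groupType) (phi : {multiplicative G -> H})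
  (g : G) n : phi (g ^+ n)%g = (phi g ^+ n)%g.
Proof.
elim: n => [|n IHn]; last by rewrite !expgS gmulfM IHn.
by apply: (mulgI (phi 1%g)); rewrite -gmulfM !mulg1.
Qed.

Theorem theorem5p1 (R : realType) (n : nat) (hn : (1 <= n)%N)
  (delta : R) (hdelta : 0 <= delta)
  (X : 'I_n -> metricType R)
  (hX : forall i, hyperbolic_space delta (X i))
  (G : groupType)
  (rho : forall i, {multiplicative G -> Isom (X i)})
  (h1 : forall i, exists f : G, hyperbolic_isometry (rho i f))
  (h2 : forall i (g : G),
     has_periodic_orbit (rho i g) \/ hyperbolic_isometry (rho i g)) :
  exists f : G, forall i, hyperbolic_isometry (rho i f).
Proof.
have K0 : 0 <= 4 * delta + 6 by lra.
have X4 i := hyperbolic_space_four_point hdelta (hX i).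
have aper i (g : G) : ~ has_periodic_orbit (rho i g) ->
    hyperbolic_isometry (rho i g) by have [] := h2 i g.
suff all_below m : (m <= n)%N -> exists f : G, forall i : 'I_n, (i < m)%N ->
    hyperbolic_isometry (rho i f).
  by have [f hf] := all_below n (leqnn n); exists f => i; exact: hf.
elim: m => [|m IHm] mn; first by exists 1%g.
have [f hf] := IHm (ltnW mn); pose i0 := Ordinal mn.
have ltS (i : 'I_n) : (i < m.+1)%N -> (i < m)%N \/ i = i0.
  by rewrite ltnS leq_eqVlt => /orP[/eqP ?|]; [right; exact: val_inj|left].
have [ellf|hypf] := h2 i0 f; last first.
  by exists f => i /ltS[/hf //|->].
have [g hg] := h1 i0.
have /fin_all_exists[kM kMP] (i : 'I_n) : exists kM : nat * nat,
    [/\ (0 < kM.1)%N, (0 < kM.2)%N & forall b, (0 < b)%N -> (kM.2 %| b)%N ->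
      exists N, forall a, (N <= a)%N -> (kM.1 %| a)%N -> (i < m)%N ->
      ~ has_periodic_orbit (rho i (f ^+ a * g ^+ b)%g)].
  have [im|im] := ltnP i m; last first.
    by exists (1, 1)%N; split=> // b _ _; exists 0%N => a _ _.
  have [kM [k0 M0 kMP]] := aperiodic_left_powers K0 (X4 i) (rho i g) (hf i im).
  exists kM; split=> // b b0 /(kMP _ b0)[N NP]; exists N => a Na ka _.
  by rewrite gmulfM !multiplicative_expg; exact: NP.
have [||b [b0 Mb bP]] := @aperiodic_right_power _ _ _ K0 (X4 i0) _ _
    (\prod_i (kM i).1)%N (\prod_i (kM i).2)%N _ _ ellf hg.
- by apply: prodn_gt0 => i; have [] := kMP i.
- by apply: prodn_gt0 => i; have [] := kMP i.
have dvd_prod (F : 'I_n -> nat) i : (F i %| \prod_j F j)%N.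
  by rewrite (bigD1 i) //= dvdn_mulr.
have /fin_all_exists[N NP] (i : 'I_n) : exists N, forall a, (N <= a)%N ->
    ((kM i).1 %| a)%N -> (i < m)%N ->
    ~ has_periodic_orbit (rho i (f ^+ a * g ^+ b)%g).
  by have [_ _] := kMP i; apply=> //; exact: dvdn_trans (dvd_prod _ i) Mb.
(* Only now, with [b] fixed, are the thresholds [N i] available for [a]. *)
have [a [Na ka aP]] := bP (\max_i N i)%N.
exists (f ^+ a * g ^+ b)%g => i /ltS[im|->]; apply: aper.
  apply: NP => //; first exact: leq_trans (leq_bigmax i) Na.
  exact: dvdn_trans (dvd_prod (fun i => (kM i).1) i) ka.
by rewrite gmulfM !multiplicative_expg.
Qed.
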